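(* Let $r\ge1$ and let $(Q_{a,k})_{a\in[1,r],k\in\mathbb{Z}}$ be nonzero complex numbers satisfying the $A_r$ Q-system $$Q_{a,k+1}Q_{a,k-1}=Q_{a,k}^2+Q_{a+1,k}Q_{a-1,k}\quad(a\in[1,r],\ k\in\mathbb{Z}),\qquad Q_{0,k}=Q_{r+1,k}=1.$$ Then for every $h\in H_1(\mathbb{T},\mathbb{Z})$ and every $k\in\mathbb{Z}$, $$H_h(Q_{1,k},\dots,Q_{r,k},Q_{1,k+1},\dots,Q_{r,k+1})=H_h(Q_{1,k+1},\dots,Q_{r,k+1},Q_{1,k+2},\dots,Q_{r,k+2}),$$ i.e. the functions $H_h$ are conserved quantities of the $A_r$ Q-system dynamics $Q_{a,k}\mapsto Q_{a,k+1}$.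
   Context: Let $\mathbb{T}=\mathbb{R}^2/(2\mathbb{Z}\times(r+1)\mathbb{Z})$. Let $G$ be the bipartite graph embedded in $\mathbb{T}$ with vertices $(x,y)$, $x\in\{0,1\}$ (mod 2), $y\in\{0,1,\dots,r\}$, where $(x,y)$ is black if $x+y$ is odd and white otherwise. Edges: for each $y\in\{0,\dots,r\}$, the two horizontal segments $[0,1]\times\{y\}$ and $[1,2]\times\{y\}$ (both joining $(0,y)$ and $(1,y)$); for each $y\in\{0,\dots,r-1\}$ and $x\in\{0,1\}$, the vertical segment $\{x\}\times[y,y+1]$. Faces: the annulus $(\mathbb{R}/2\mathbb{Z})\times(r,r+1)$ is labeled $0$; for $a\in[1,r]$, if $a$ is odd the square $(0,1)\times(a-1,a)$ is labeled $a$ and $(1,2)\times(a-1,a)$ is labeled $r+a$, and if $a$ is even the square $(1,2)\times(a-1,a)$ is labeled $a$ and $(0,1)\times(a-1,a)$ is labeled $r+a$. Face $0$ has weight $A_0:=1$ and face $i\in[1,2r]$ has weight $A_i\in\mathbb{C}^*$. Weight of a perfect matching $M$: $w(M)=\prod_{e\in M}(A_iA_j)^{-1}$, where $i,j$ are the faces on the two sides of $e$. Reference matching $M_0$: for each $y\in\{0,\dots,r\}$, the one horizontal edge at height $y$ whose left endpoint ($(0,y)$ for $[0,1]\times\{y\}$, $(1,y)$ for $[1,2]\times\{y\}$) is black. For a perfect matching $M$, orient the edges of $M$ from black to white and those of $M_0$ from white to black, discard common edges; $[M]_{M_0}\in H_1(\mathbb{T},\mathbb{Z})$ is the homology class of the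 resulting union of oriented loops. The Hamiltonian is $H_h(A_1,\dots,A_{2r})=\sum_{M:[M]_{M_0}=h}w(M)/w(M_0)$ over perfect matchings $M$ of $G$. *)

(* Defs.v *)
From HB Require Import structures.
From mathcomp Require Import all_boot all_order all_algebra.
From mathcomp Require Import boolp reals complex ring lra.

Set Implicit Arguments.
Unset Strict Implicit.
Unset Printing Implicit Defensive.
Import GRing.Theory.
Local Open Scope ring_scope.
Local Open Scope quotient_scope.

(* The torus T = R^2/(2Z x (r+1)Z) carries the square-grid cell structure whose
   cells are indexed by Z/2 x Z/(r+1), with the cyclic successor ordS and
   predecessor ord_pred on each factor:
   - 0-cell (x, y): the point (x, y);
   - 1-cell (true, (x, y)): the segment [x, x+1] x {y}, oriented rightwards;
     1-cell (false, (x, y)): the segment {x} x [y, y+1], oriented upwards;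
   - 2-cell (x, y): the square (x, x+1) x (y, y+1), oriented counterclockwise.
   The graph G consists of all the 0-cells and of all the 1-cells except the two
   segments {x} x [r, r+1], which cut its annular face into two squares. *)
Section Torus.
Variable r : nat.

Definition vertex := ('I_2 * 'I_r.+1)%type.
Definition edge := (bool * vertex)%type.
Definition square := ('I_2 * 'I_r.+1)%type.

Definition horizontal (e : edge) : bool := e.1.
Definition source (e : edge) : vertex := e.2.
Definition target (e : edge) : vertex :=
  let: (x, y) := e.2 in if horizontal e then (ordS x, y) else (x, ordS y).

(* Squares to the left and to the right of an edge oriented as above. *)
Definition left_square (e : edge) : square :=
  let: (x, y) := e.2 in if horizontal e then (x, y) else (ord_pred x, y).
Definition right_square (e : edge) : square :=
  let: (x, y) := e.2 in if horizontal e then (x, ord_pred y) else (x, y).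

(* H_1(T, Z) is the cellular homology of this cell structure. *)
Definition chain1 := {ffun edge -> int}.
Definition chain2 := {ffun square -> int}.

Definition bdry1 (z : chain1) : {ffun vertex -> int} :=
  [ffun v => \sum_(e | target e == v) z e - \sum_(e | source e == v) z e].
Definition bdry2 (c : chain2) : chain1 :=
  [ffun e => c (left_square e) - c (right_square e)].

Fact bdry1_is_zmod_morphism : zmod_morphism bdry1.
Proof.
move=> u v; apply/ffunP => w; rewrite !ffunE.
have sumE (P : pred edge) :
    \sum_(e | P e) (u - v) e = \sum_(e | P e) u e - \sum_(e | P e) v e.
  by rewrite -sumrB; apply: eq_bigr => e _; rewrite !ffunE.
by rewrite !sumE; ring.
Qed.
HB.instance Definition _ :=
  GRing.isZmodMorphism.Build chain1 {ffun vertex -> int} bdry1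
    bdry1_is_zmod_morphism.

Fact bdry2_is_zmod_morphism : zmod_morphism bdry2.
Proof. by move=> c d; apply/ffunP => e; rewrite !ffunE; ring. Qed.
HB.instance Definition _ :=
  GRing.isZmodMorphism.Build chain2 chain1 bdry2 bdry2_is_zmod_morphism.

Fact bdry1_bdry2 (c : chain2) : bdry1 (bdry2 c) = 0.
Proof.
apply/ffunP => -[x y]; rewrite !ffunE.
have split_sum (P : pred edge) (g : edge -> int) : \sum_(e | P e) g e =
    \sum_(v | P (true, v)) g (true, v) + \sum_(v | P (false, v)) g (false, v).
  rewrite !(big_mkcond (fun v => P (_, v))) [LHS]big_mkcond /=.
  rewrite -(big_bool _ (fun b => \sum_v if P (b, v) then g (b, v) else 0)).
  by rewrite pair_bigA /=; apply: eq_bigr => -[].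
have predE n (i j : 'I_n) : (ordS i == j) = (i == ord_pred j).
  exact: can2_eq (@ordSK _) (@ord_predK _) _ _.
rewrite !split_sum (big_pred1 (ord_pred x, y)); last first.
  by move=> [x' y']; rewrite /target /= !xpair_eqE predE.
rewrite (big_pred1 (x, ord_pred y)); last first.
  by move=> [x' y']; rewrite /target /= !xpair_eqE predE.
rewrite !(big_pred1 (x, y)) //.
by rewrite !ffunE /left_square /right_square /=; ring.
Qed.

Definition cycles : {pred chain1} := [pred z | bdry1 z == 0].

Fact cycles_closed : zmod_closed cycles.
Proof.
split=> [|u v]; rewrite !inE ?raddf0 //.
by move=> /eqP u0 /eqP v0; rewrite raddfB /= u0 v0 subrr.
Qed.
HB.instance Definition _ :=
  GRing.isZmodClosed.Build chain1 cycles cycles_closed.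

Record cycle1 := Cycle1 { cycle1_val :> chain1; _ : cycle1_val \in cycles }.
HB.instance Definition _ := [isSub for cycle1_val].
HB.instance Definition _ := [Choice of cycle1 by <:].
HB.instance Definition _ := [SubChoice_isSubZmodule of cycle1 by <:].

Definition boundaries : {pred cycle1} :=
  [pred z | `[< exists c : chain2, val z = bdry2 c >]].

Fact boundaries_closed : zmod_closed boundaries.
Proof.
split=> [|u v]; rewrite !inE.
  by apply/asboolP; exists 0; rewrite !raddf0.
move=> /asboolP[c uc] /asboolP[d vd]; apply/asboolP; exists (c - d).
by rewrite !raddfB /= uc vd.
Qed.
HB.instance Definition _ :=
  GRing.isZmodClosed.Build cycle1 boundaries boundaries_closed.

Definition H1 := Quotient.quot (boundaries : zmodClosed cycle1).
HB.instance Definition _ := GRing.Zmodule.on H1.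

Definition black (v : vertex) : bool := odd (v.1 + v.2).

Definition graph_edges : {set edge} :=
  [set e | horizontal e || ((source e).2 < r)%N].

Definition incident (e : edge) (v : vertex) : bool :=
  (source e == v) || (target e == v).

Definition perfect (M : {set edge}) : bool :=
  (M \subset graph_edges) && [forall v, #|[set e in M | incident e v]| == 1%N].

Record matching := Matching { matching_val :> {set edge}; _ : perfect matching_val }.
HB.instance Definition _ := [isSub for matching_val].
HB.instance Definition _ := [Finite of matching by <:].

(* The source of a horizontal edge is its left endpoint. *)
Definition M0_set : {set edge} := [set e | horizontal e && black (source e)].

Lemma odd_ordS (x : 'I_2) : odd (ordS x) = ~~ odd x.
Proof. by case: x => -[|[|//]]. Qed.

Lemma odd_inj2 (x y : 'I_2) : odd x = odd y -> x = y.
Proof. by case: x y => -[|[|//]] ? [[|[|//]] ?] // _; apply/val_inj. Qed.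

Fact M0_perfect : perfect M0_set.
Proof.
apply/andP; split; first by apply/subsetP => e; rewrite !inE => /andP[->].
apply/forallP => -[x y]; pose x0 := if black (x, y) then x else ord_pred x.
have x0odd : odd (x0 + y).
  rewrite /x0 /black /=; case: ifPn => // nb.
  move: nb; rewrite -{1}(ord_predK x) !oddD odd_ordS.
  by case: (odd _); case: (odd _).
apply/cards1P; exists (true, (x0, y)); apply/setP => e.
rewrite !inE; apply/idP/eqP => [|->].
  case: e => [[] [x' y']] //; rewrite /incident /black /source /target /=.
  rewrite /horizontal /= => /andP[bx' /orP[]/eqP[_ yE]];
    rewrite yE in bx' *; congr (_, (_, _)); apply/odd_inj2;
    by move: bx' x0odd; rewrite !oddD; do 3 case: (odd _).
rewrite /horizontal /= /black /= x0odd /incident /source /target /= /x0.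
by case: ifP; rewrite ?ord_predK eqxx ?orbT.
Qed.

Definition M0 : matching := Matching M0_perfect.

(* +1 when e, traversed from its black to its white endpoint, follows the
   orientation of the cell structure. *)
Definition orient (e : edge) : int := if black (source e) then 1 else -1.

(* M traversed from black to white plus M0 traversed from white to black;
   common edges cancel. *)
Definition matching_chain (M : matching) : chain1 :=
  [ffun e => orient e *+ (e \in (M : {set edge}))
             - orient e *+ (e \in (M0 : {set edge}))].

Lemma black_target e : e \in graph_edges -> black (target e) = ~~ black (source e).
Proof.
case: e => [[] [x y]]; rewrite inE /black /target /source /= => yr.
  by rewrite !oddD odd_ordS addNb.
by rewrite modn_small // addnS.
Qed.

Lemma matching_flow (M : matching) v :
  \sum_(e in (M : {set edge}) | target e == v) orient e
  - \sum_(e in (M : {set edge}) | source e == v) orient e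
  = if black v then -1 else 1.
Proof.
case: M => M /= /andP[/subsetP MG /forallP/(_ v)/cards1P[e0 e0E]].
have inM e : e \in M -> (source e == v) || (target e == v) = (e == e0).
  by move=> eM; have /setP/(_ e) := e0E; rewrite !inE eM.
have /setP/(_ e0) := e0E; rewrite !inE eqxx => /andP[e0M e0v].
have ne0 : target e0 != source e0.
  by apply/eqP => h; have := black_target (MG _ e0M); rewrite h; case: black.
have sumE (f : edge -> vertex) :
    (forall e, f e == v -> (source e == v) || (target e == v)) ->
  \sum_(e in M | f e == v) orient e = if f e0 == v then orient e0 else 0.
  move=> fv; case: ifP => [fe0|fe0].
    apply: big_pred1 => e /=; apply/andP/eqP => [[eM /fv]|-> //].
    by rewrite inM // => /eqP.
  rewrite big1 // => e /andP[eM ev]; have := fv _ ev.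
  by rewrite inM // => /eqP ee; rewrite ee fe0 in ev.
rewrite !sumE; [|by move=> e ->|by move=> e ->; rewrite orbT].
have bt := black_target (MG _ e0M).
case/orP: (e0v) => /eqP ev; move: ne0 bt; rewrite /orient ev eqxx => /negPf.
  by move=> -> _; rewrite sub0r; case: black; rewrite ?opprK.
by rewrite eq_sym => -> ->; rewrite subr0; case: black.
Qed.

Fact matching_chain_cycle (M : matching) : matching_chain M \in cycles.
Proof.
rewrite inE; apply/eqP/ffunP => v; rewrite !ffunE.
have sumE (f : edge -> vertex) :
  \sum_(e | f e == v) matching_chain M e =
  \sum_(e in (M : {set edge}) | f e == v) orient e
  - \sum_(e in (M0 : {set edge}) | f e == v) orient e.
  under eq_bigr do rewrite ffunE.
  rewrite sumrB; congr (_ - _); rewrite big_mkcond [RHS]big_mkcond;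
    by apply: eq_bigr => e _; case: (e \in _); case: eqP.
by have := matching_flow M v; have := matching_flow M0 v; rewrite !sumE; lra.
Qed.

(* [M]_{M0} *)
Definition homology_class (M : matching) : H1 :=
  \pi_H1 (Cycle1 (matching_chain_cycle M)).

(* Label of the face of G containing a square. *)
Definition face_label (s : square) : nat :=
  let a := s.2.+1 in
  if s.2 == r :> nat then 0%N
  else if (s.1 == 0 :> nat) == odd a then a else (r + a)%N.

Section Hamiltonian.
Variable F : fieldType.

(* The weights of the faces 1, ..., 2r are the values of A at 1, ..., 2r. *)
Definition face_weight (A : nat -> F) (i : nat) : F :=
  if i == 0%N then 1 else A i.

Definition weight (A : nat -> F) (M : matching) : F :=
  \prod_(e in (M : {set edge}))
    (face_weight A (face_label (left_square e)) *
     face_weight A (face_label (right_square e)))^-1.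

Definition hamiltonian (h : H1) (A : nat -> F) : F :=
  \sum_(M : matching | homology_class M == h) weight A M / weight A M0.

(* (A_1, ..., A_2r) = (Q_{1,k}, ..., Q_{r,k}, Q_{1,k+1}, ..., Q_{r,k+1}) *)
Definition Q_slice (Q : nat -> int -> F) (k : int) (i : nat) : F :=
  if (i <= r)%N then Q i k else Q (i - r)%N (k + 1).

End Hamiltonian.
End Torus.

(* Main.v *)
Require Import Defs.
From HB Require Import structures.
From mathcomp Require Import all_boot all_order all_algebra.
From mathcomp Require Import boolp reals complex.
From mathcomp Require Import ring lra zify.
Import GRing.Theory.
Local Open Scope ring_scope.

(* A perfect matching of the ladder G consists of rungs and of pairs of parallel
   vertical edges, and its homology class is determined by the number of rungs
   outside M0 plus the number of vertical pairs. Expanding along the top row, the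
   polynomial counting matchings by that number, normalized by w(M0), is a
   continuant P_(m+1) = (1 + R_m X) P_m + D_(m-1) X P_(m-1), where, with
   u_i = Q_(i,k) and v_i = Q_(i,k+1),
     R_i = v_(i+1) u_i / (u_(i+1) v_i),  D_i = u_i v_(i+2) / (u_(i+1) v_(i+1)).
   If R', D', P' are built from the next time step, the Q-system gives
   R'_(m+1) + D'_m = R_(m+1) + D_(m+1) and D_m R'_(m+1) = D'_m R_m, whence
   P'_(m+1) = P_(m+1) + D_m X P_m. Setting v_(r+2) = 0 keeps the Q-system relation
   valid in row r + 1 and makes D_r = 0, so that P'_(r+1) = P_(r+1). *)

(** * Weighted matchings of induced subgraphs of G *)

Section MatchingSum.
Set Implicit Arguments.
Unset Strict Implicit.
Variables (r : nat) (K : comNzRingType) (w : edge r -> K).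
Implicit Types (X : {set vertex r}) (M : {set edge r}) (e : edge r).

Definition ends e : {set vertex r} := [set v | incident e v].

(** Perfect matchings of the subgraph induced on X, kept as edge sets of the whole graph so that X
    can shrink while the types stay fixed. *)
Definition matches X M : bool :=
  (M \subset graph_edges r) &&
  [forall v, #|[set e in M | incident e v]| == (v \in X) :> nat].

Definition matching_sum X : K := \sum_(M | matches X M) \prod_(e in M) w e.

Lemma matches_ends X M e : matches X M -> e \in M -> ends e \subset X.
Proof.
move=> /andP[_ /forallP XM] eM; apply/subsetP => v; rewrite inE => ev.
move: (XM v); case: (v \in X) => //; rewrite cards_eq0 => /eqP/setP/(_ e).
by rewrite !inE eM ev.
Qed.

Lemma matches_setU1 X M e : e \in graph_edges r -> e \notin M ->
  ends e \subset X -> matches X (e |: M) = matches (X :\: ends e) M.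
Proof.
move=> eG eM /subsetP eX; rewrite /matches subUset sub1set eG /=.
congr andb; apply: eq_forallb => v; rewrite in_setD.
have -> : [set f in e |: M | incident f v] =
    if v \in ends e then e |: [set f in M | incident f v]
    else [set f in M | incident f v].
  apply/setP => f; rewrite [v \in ends e]inE; case: ifP => ev; rewrite !inE;
  by case: eqP => [->|//]; rewrite ev ?andbF.
case: ifP => ev //; rewrite cardsU1 !inE (negPf eM) (eX _ ev) /= add1n eqSS.
by [].
Qed.

(** Each matching of X has exactly one edge e at v, and deleting e is a bijection onto the matchings
    of X without the ends of e. *)
Lemma matching_sum_expand X v : v \in X ->
  matching_sum X = \sum_(e in graph_edges r | incident e v && (ends e \subset X))
                      w e * matching_sum (X :\: ends e).
Proof.
(* The added inner sum has a single term; it turns the edge at v into a summation index. *)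
move=> vX; transitivity (\sum_(M | matches X M)
    \sum_(e | (e \in M) && incident e v) \prod_(e in M) w e).
  apply: eq_bigr => M /andP[_ /forallP/(_ v)]; rewrite vX => /eqP cM.
  rewrite [RHS](eq_bigl (mem [set e in M | incident e v])); last first.
    by move=> e; rewrite !inE.
  by rewrite sumr_const cM.
rewrite (exchange_big_dep (fun e => (e \in graph_edges r) &&
  (incident e v && (ends e \subset X)))) /=; last first.
  move=> M e XM /andP[eM ->]; rewrite (matches_ends XM eM) !andbT.
  by case/andP: XM => /subsetP/(_ e eM).
apply: eq_bigr => e /andP[eG /andP[ev eX]]; rewrite big_distrr /=.
rewrite (reindex_onto (fun M => e |: M) (fun M => M :\ e)) /=; last first.
  by move=> M /andP[_ /andP[eM _]]; rewrite setD1K.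
have NeM M : matches (X :\: ends e) M -> e \notin M.
  move=> XM; apply/negP => eM; have /subsetP/(_ v) := matches_ends XM eM.
  by rewrite !inE ev => /(_ isT).
apply: eq_big => [M|M].
  rewrite setU11 ev !andbT; case: (boolP (e \in M)) => eM.
    rewrite (contraTF (NeM M)) ?eM // andbC; case: eqP => // /setP/(_ e).
    by rewrite !inE eqxx eM.
  by rewrite setU1K // eqxx andbT matches_setU1.
move=> /andP[_ /eqP eM]; rewrite big_setU1 // -eM.
by rewrite !inE eqxx.
Qed.

Lemma matching_sum0 : matching_sum set0 = 1.
Proof.
rewrite /matching_sum (big_pred1 set0) ?big_set0 // => M; apply/idP/eqP => [M0|->].
  apply/eqP/set0Pn => -[e eM]; have /subsetP/(_ (source e)) := matches_ends M0 eM.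
  by rewrite !inE /incident eqxx => /(_ isT).
rewrite /matches sub0set; apply/forallP => v; rewrite inE.
by rewrite cards_eq0; apply/eqP/setP => e; rewrite !inE.
Qed.

End MatchingSum.

(** * The row recursion on the ladder *)

Section Ladder.
Set Implicit Arguments.
Unset Strict Implicit.
Variable r : nat.
Implicit Types (x : 'I_2) (y : 'I_r.+1) (v : vertex r).

Lemma eq_or_eq_ordS2 x x' : (x' == x) || (x' == ordS x).
Proof. by case: x x' => -[|[|//]] ? [[|[|//]] ?]. Qed.

Lemma incident_horizontal x y v : incident (true, (x, y)) v = (v.2 == y).
Proof.
case: v => x' y'; rewrite /incident /source /target /= !xpair_eqE.
by rewrite -andb_orl ![_ == x']eq_sym eq_or_eq_ordS2 eq_sym.
Qed.

Lemma incident_vertical x y v : (y < r)%N -> incident (false, (x, y)) v =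
  (v.1 == x) && ((v.2 == y :> nat) || (v.2 == y.+1 :> nat)).
Proof.
case: v => x' y' yr; rewrite /incident /source /target /= !xpair_eqE.
rewrite -andb_orr eq_sym -!val_eqE /= modn_small //; congr andb.
by rewrite ![_ == y' :> nat]eq_sym.
Qed.

Definition rows m : {set vertex r} := [set v : vertex r | (v.2 < m)%N].


(** Indexing rows by natural numbers lets recursions run without bound proofs; beyond r the value is
    the default row 0. *)
Definition rowi m : 'I_r.+1 := inord m.

(** Expand at the vertex (0, m). It is covered by one of the two rungs of row m or by the vertical
    edge down to row m - 1; in the last case the other vertex of row m can only use the parallel
    vertical edge. *)
Lemma matching_sum_rows (K : comNzRingType) (w : edge r -> K) m : (m <= r)%N ->
  matching_sum w (rows m.+1) =
  (w (true, (ord0, rowi m)) + w (true, (ord_max, rowi m))) * matching_sum w (rows m)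
  + (if m is p.+1 then w (false, (ord0, rowi p)) * w (false, (ord_max, rowi p)) *
       matching_sum w (rows p) else 0).
Proof.
move=> mr.
have rowE p : (p <= m)%N -> rowi p = p :> nat.
  by move=> pm; rewrite inordK ?ltnS ?(leq_trans pm).
have v0 : (ord0, rowi m) \in rows m.+1 by rewrite inE /= rowE.
rewrite (matching_sum_expand _ v0).
have subH x : (ends (true, (x, rowi m)) \subset rows m.+1) = true.
  by apply/subsetP => v; rewrite !inE incident_horizontal => /eqP->; rewrite rowE.
have diffH x : rows m.+1 :\: ends (true, (x, rowi m)) = rows m.
  apply/setP => v; rewrite !inE incident_horizontal ltnS -val_eqE /= rowE //.
  by rewrite ltn_neqAle.
rewrite mulrDl -addrA.
rewrite (bigD1 (true, (ord0, rowi m))) /=; last first.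
  by rewrite inE /= incident_horizontal eqxx subH.
rewrite (bigD1 (true, (ord_max, rowi m))) /=; last first.
  by rewrite inE /= incident_horizontal eqxx subH.
rewrite !diffH; congr (_ + (_ + _)).
have horiz x y : incident (true, (x, y)) (ord0, rowi m) ->
    (true, (x, y)) != (true, (ord0, rowi m)) ->
    (true, (x, y)) != (true, (ord_max, rowi m)) -> False.
  rewrite incident_horizontal => /eqP /= <-.
  by case: x => [[|[|//]]] ? /eqP h1 /eqP h2; [apply: h1|apply: h2];
    congr (_, (_, _)); apply/val_inj.
(* The upper end must also lie in the first m + 1 rows, which excludes the edge going up from row
   m. *)
have vert x y : (y < r)%N -> ends (false, (x, y)) \subset rows m.+1 -> (y < m)%N.
  move=> yr /subsetP/(_ (x, ordS y)); rewrite !inE incident_vertical //= eqxx.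
  by rewrite modn_small // eqxx orbT ltnS => ->.
case: m mr rowE v0 subH diffH horiz vert => [|p] pr rowE v0 subH diffH horiz vert.
  apply: big1 => -[[] [x y]]; rewrite inE /=.
    by move=> /andP[/andP[/andP[/horiz]]] h _ /h /[apply].
  by move=> /andP[/andP[/andP[yr /andP[_ /(vert _ _ yr)]]]].
have pr' : (rowi p < r)%N by rewrite rowE.
have subV x : (ends (false, (x, rowi p)) \subset rows p.+2) = true.
  apply/subsetP => v; rewrite !inE incident_vertical // rowE //.
  by move=> /andP[_ /orP[]/eqP->].
rewrite (bigD1 (false, (ord0, rowi p))) /=; last first.
  by rewrite inE /= subV pr' incident_vertical //= !rowE // eqxx orbT.
rewrite [X in _ + X]big1 ?addr0; last first.
  move=> -[[] [x y]]; rewrite inE /=.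
    by move=> /andP[/andP[/andP[/andP[/horiz]]]] h _ /h /[apply].
  move=> /andP[/andP[/andP[/andP[yr /andP[iv /(vert _ _ yr) yp]]]]] _ _ /eqP[].
  move: iv; rewrite incident_vertical //= rowE // => /andP[/eqP<-].
  move=> yE; congr (_, (_, _)); apply/val_inj; rewrite /= rowE //; lia.
rewrite -mulrA; congr (_ * _).
(* With the vertical edge at x = 0 used, both rungs at [(ord_max, rowi p.+1)] end at a removed
   vertex. *)
pose X := rows p.+2 :\: ends (false, (ord0, rowi p)).
have inX x y : ((x, y) \in X) =
    ((y < p.+2) && ~~ ((x == ord0) && ((y == p :> nat) || (y == p.+1 :> nat))))%N.
  by rewrite !inE incident_vertical //= rowE // andbC.
have v1 : (ord_max, rowi p.+1) \in X by rewrite inX rowE // ltnS leqnn.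
rewrite (matching_sum_expand _ v1) (big_pred1 (false, (ord_max, rowi p))).
  congr (_ * matching_sum _ _); apply/setP => -[x y].
  rewrite in_setD inX !inE !incident_vertical //= !rowE //.
  by case: x => [[|[|//]]] ? /=; lia.
move=> [[] [x y]]; rewrite inE /=.
  rewrite incident_horizontal; case: eqP => //= <-.
  apply/negP => /subsetP/(_ (ord0, rowi p.+1)).
  by rewrite inE incident_horizontal inX !rowE //= !eqxx orbT andbF => /(_ isT).
apply/andP/eqP => [[yr /andP[iv /subsetP eX]]|[-> ->]].
  have := eX (x, y); rewrite inE incident_vertical //= !eqxx inX => /(_ isT).
  have := eX (x, ordS y).
  rewrite inE incident_vertical //= modn_small // !eqxx orbT => /(_ isT).
  rewrite inX /= modn_small // => h1 h2.
  move: iv; rewrite incident_vertical //= rowE // => /andP[/eqP-> h3].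
  congr (_, (_, _)); apply/val_inj; rewrite /= rowE //; lia.
split=> //; rewrite incident_vertical //= !rowE // !eqxx orbT /=.
apply/subsetP => -[x' y']; rewrite inE incident_vertical // inX rowE //=.
by case: x' => [[|[|//]]] ? /=; lia.
Qed.

End Ladder.

(** * Flux determines the homology class *)

Section Homology.
Set Implicit Arguments.
Unset Strict Implicit.
Variable r : nat.
Implicit Types (x : 'I_2) (y : 'I_r.+1) (D : chain1 r) (M : matching r).

Lemma bdry1E D x y : bdry1 D (x, y) =
  D (true, (ord_pred x, y)) + D (false, (x, ord_pred y))
  - (D (true, (x, y)) + D (false, (x, y))).
Proof.
rewrite ffunE.
have split_sum (P : pred (edge r)) : \sum_(e | P e) D e =
    \sum_(v | P (true, v)) D (true, v) + \sum_(v | P (false, v)) D (false, v).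
  rewrite !(big_mkcond (fun v => P (_, v))) [LHS]big_mkcond /=.
  rewrite -(big_bool _ (fun b => \sum_v if P (b, v) then D (b, v) else 0)).
  by rewrite pair_bigA /=; apply: eq_bigr => -[].
have predE n (i j : 'I_n) : (ordS i == j) = (i == ord_pred j).
  exact: can2_eq (@ordSK _) (@ord_predK _) _ _.
rewrite !split_sum (big_pred1 (ord_pred x, y)); last first.
  by move=> [x' y']; rewrite /target /= !xpair_eqE predE.
rewrite (big_pred1 (x, ord_pred y)); last first.
  by move=> [x' y']; rewrite /target /= !xpair_eqE predE.
by rewrite !(big_pred1 (x, y)).
Qed.

Lemma rowi_ord y : rowi r y = y.
Proof. exact: inord_val. Qed.

Lemma rowi_ord_pred0 : rowi r r = ord_pred ord0.
Proof. by apply/val_inj; rewrite /= inordK // modn_small. Qed.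

Lemma rowi_ord_predS n : (n.+1 <= r)%N -> rowi r n = ord_pred (rowi r n.+1).
Proof.
move=> nr; apply/val_inj; rewrite /= !inordK //; last by rewrite ltnW.
by rewrite addSn /= modnDr modn_small // ltnW.
Qed.

(* Integrating D upwards from the annulus, which D does not cross. *)
Lemma boundary_of_flux0 D : bdry1 D = 0 -> (forall x, D (false, (x, ord_max)) = 0) ->
  \sum_y D (true, (ord0, y)) = 0 -> exists c : chain2 r, D = bdry2 c.
Proof.
move=> /ffunP D0 Dtop flux0.
(* These partial sums up column x will be the coefficients of the bounding 2-chain on the squares of
   that column. *)
pose S x n := \sum_(j < n.+1) D (true, (x, rowi r j)).
have Sr x : S x r = \sum_y D (true, (x, y)).
  by apply: eq_bigr => y _; rewrite rowi_ord.
have rowr : rowi r r = ord_max by apply/val_inj; rewrite /= inordK.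
have row0 : rowi r 0 = ord0 by apply/val_inj; rewrite /= inordK.
have SV x n : (n <= r)%N -> S (ord_pred x) n - S x n = D (false, (x, rowi r n)).
  elim: n => [|n IHn] nr.
    have := D0 (x, rowi r 0); rewrite bdry1E !ffunE row0 -rowi_ord_pred0 rowr Dtop.
    by rewrite /S !big_ord1 /= row0; lra.
  have := D0 (x, rowi r n.+1); rewrite bdry1E !ffunE -rowi_ord_predS // -IHn 1?ltnW //.
  by rewrite /S [in X in _ -> X]big_ord_recr [X in _ -> _ - X = _]big_ord_recr /=; lra.
(* The cyclic predecessor of row 0 is row r, so the coefficients there must vanish for the
   horizontal edges at height 0 to come out right. *)
have Sr0 x : S x r = 0.
  have S0 : S ord0 r = 0 by rewrite Sr.
  have := SV ord0 r (leqnn r); rewrite rowr Dtop S0 subr0 => S1.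
  have := eq_or_eq_ordS2 (ord_pred ord0) x; rewrite ord_predK.
  by move=> /orP[]/eqP->.
exists [ffun s : square r => S s.1 s.2].
apply/ffunP => -[[] [x y]]; rewrite !ffunE /=; last first.
  by rewrite SV ?rowi_ord // -ltnS.
rewrite -{1}(rowi_ord y); case: y => -[|n] ny /=.
  by rewrite modn_small // Sr0 subr0 /S big_ord1.
rewrite modnDr modn_small 1?ltnW // [X in _ = X - _]/S big_ord_recr /=.
by rewrite addrAC subrr add0r.
Qed.

(** Algebraic intersection number with the vertical circle x = 1/2, edges being traversed from black
    to white. *)
Definition flux (M : {set edge r}) : int :=
  \sum_y orient (true, (ord0, y)) *+ ((true, (ord0, y)) \in M).

(** The contributions of [M0] cancel in the difference of the two chains. This cycle does not cross
    the annulus, where G has no vertical edge, and its flux is 0, so it bounds. *)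
Lemma homology_class_flux M M' :
  flux M = flux M' -> homology_class M = homology_class M'.
Proof.
move=> fM; apply/eqP; rewrite -Quotient.idealrBE.
have valB : val (Cycle1 (matching_chain_cycle M) - Cycle1 (matching_chain_cycle M'))
    = matching_chain M - matching_chain M' by rewrite raddfB.
apply/asboolP; rewrite valB; apply: boundary_of_flux0 => [|x|].
- rewrite raddfB /=; have:= matching_chain_cycle M; have:= matching_chain_cycle M'.
  by rewrite !inE => /eqP-> /eqP->; rewrite subrr.
- have top (N : matching r) : ((false, (x, ord_max)) \in (N : {set edge r})) = false.
    apply/negP => eN; case/andP: (valP N) => /subsetP/(_ _ eN).
    by rewrite inE /= ltnn.
  by rewrite !ffunE !top !subrr.
- move: fM; rewrite /flux => /eqP; rewrite -subr_eq0 -sumrB => /eqP fM.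
  by rewrite -[RHS]fM; apply: eq_bigr => y _; rewrite !ffunE; lra.
Qed.

End Homology.

(** * Continuants and their transformation rules *)

Section Continuant.
Set Implicit Arguments.
Unset Strict Implicit.
Variable K : comNzRingType.
Implicit Types a b c : nat -> K.

(** Determinant of the tridiagonal matrix with diagonal entries a i and products of opposite
    off-diagonal entries - b i. *)
Fixpoint continuant a b n : K :=
  if n is m.+1 then
    a m * continuant a b m + (if m is p.+1 then b p * continuant a b p else 0)
  else 1.

Lemma continuantSS a b n : continuant a b n.+2 =
  a n.+1 * continuant a b n.+1 + b n * continuant a b n.
Proof. by []. Qed.

Lemma eq_continuant a b a' b' n :
  (forall i, (i < n)%N -> a i = a' i) ->
  (forall i, (i.+1 < n)%N -> b i = b' i) ->
  continuant a b n = continuant a' b' n.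
Proof.
elim/ltn_ind: n => -[|[|n]] IH aE bE //; first by rewrite /= aE.
rewrite !continuantSS aE // bE // !IH // => i ni; by [apply: aE; lia | apply: bE; lia].
Qed.

(** Every monomial of the continuant covers each index i < n once, either by a i or by a pair b i
    covering i and i + 1. *)
Lemma continuant_scale c a b n :
  continuant (fun i => c i * a i) (fun i => c i * c i.+1 * b i) n =
  (\prod_(i < n) c i) * continuant a b n.
Proof.
elim/ltn_ind: n => -[|[|n]] IH; first by rewrite big_ord0 mulr1.
  by rewrite /= big_ord_recr big_ord0 /=; ring.
by rewrite !continuantSS !IH // !big_ord_recr /=; ring.
Qed.

(** Used with a = 1 + R X and b = D X, and likewise for a', b' at the next time step: the hypotheses
    then become the relations between R, D, R', D'. *)
Lemma continuant_shift a b a' b' n :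
    a' 0%N = a 0%N + b 0%N ->
    (forall m, (m < n)%N -> a' m.+1 + b' m = a m.+1 + b m.+1) ->
    (forall m, (m < n)%N -> b m * (a' m.+1 - 1) = b' m * (a m - 1)) ->
  continuant a' b' n.+1 = continuant a b n.+1 + b n * continuant a b n.
Proof.
move=> ab0 abD abM; suff: forall m, (m <= n)%N ->
  continuant a' b' m.+1 = continuant a b m.+1 + b m * continuant a b m by apply.
elim/ltn_ind => -[|[|m]] IH mn; first by rewrite /= ab0; ring.
  have /eqP := abD 0%N mn; rewrite -subr_eq0 => /eqP hD.
  have /eqP := abM 0%N mn; rewrite -subr_eq0 => /eqP hM.
  apply/eqP; rewrite -subr_eq0 !continuantSS /= ab0.
  rewrite [X in X == 0](_ : _ = (a' 1%N + b' 0%N - (a 1%N + b 1%N)) * a 0%N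
    + (b 0%N * (a' 1%N - 1) - b' 0%N * (a 0%N - 1))); last by ring.
  by rewrite hM hD mul0r addr0.
have /eqP := abD m.+1 mn; rewrite -subr_eq0 => /eqP hD.
have /eqP := abM m.+1 mn; rewrite -subr_eq0 => /eqP hM.
apply/eqP; rewrite -subr_eq0.
rewrite (continuantSS a') (continuantSS a b m.+1).
rewrite !IH ?ltnS ?leqnSn ?leqnn ?(ltnW mn) ?(ltnW (ltnW mn)) //.
rewrite !(continuantSS a b m); set x := continuant a b m.+1; set y := continuant a b m.
(* After the two induction hypotheses, the defect is the additive relation times the continuant of
   order m + 2 plus the multiplicative one times that of order m + 1. *)
rewrite [X in X == 0](_ : _ =
    (a' m.+2 + b' m.+1 - (a m.+2 + b m.+2)) * (a m.+1 * x + b m * y) +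
  (b m.+1 * (a' m.+2 - 1) - b' m.+1 * (a m.+1 - 1)) * x); last by ring.
by rewrite hM hD !mul0r addr0.
Qed.

End Continuant.

(** * A degree on matchings equivalent to the flux *)

Section Degree.
Set Implicit Arguments.
Unset Strict Implicit.
Variable r : nat.

Lemma big_edge T (idx : T) (op : Monoid.com_law idx) (f : edge r -> T) :
  \big[op/idx]_e f e = \big[op/idx]_y
    op (op (f (true, (ord0, y))) (f (true, (ord_max, y))))
       (op (f (false, (ord0, y))) (f (false, (ord_max, y)))).
Proof.
rewrite (eq_bigr (fun e => f (e.1, e.2))) => [|[]//].
rewrite -(pair_bigA _ (fun b v => f (b, v))) /= big_bool /=.
have pairE b : \big[op/idx]_v f (b, v) =
    \big[op/idx]_y op (f (b, (ord0, y))) (f (b, (ord_max, y))).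
  rewrite (eq_bigr (fun v => f (b, (v.1, v.2)))) => [|[]//].
  rewrite -(pair_bigA _ (fun x y => f (b, (x, y)))) /= big_split.
  rewrite big_ord_recl big_ord1; congr (_ _ _); apply: eq_bigr => y _.
  by congr (f (_, (_, _))); apply/val_inj.
by rewrite !pairE !big_split.
Qed.

(* The weight of a pair of parallel vertical edges is carried by the one at x = 1. *)
Definition edge_degree (e : edge r) : nat :=
  let: (b, (x, y)) := e in if b then ~~ odd (x + y) : nat else x : nat.

Definition degree (M : {set edge r}) : nat := (\sum_(e in M) edge_degree e)%N.

(* Both sides count the vertices (1, y) with y odd: every such vertex is
   covered by exactly one edge of M. *)
Lemma flux_degree (M : matching r) :
  flux M + (degree M)%:R = \sum_(y < r.+1 | odd y) 1.
Proof.
transitivity (\sum_(y < r.+1 | odd y)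
    \sum_(e in (M : {set edge r}) | incident e (ord_max, y)) 1 : int).
  rewrite (exchange_big_dep (mem (M : {set edge r}))) => [|y e _ /andP[]//] /=.
  have -> : flux M = \sum_(e in (M : {set edge r})) if e is (true, (x, y)) then
      orient (true, (x, y)) *+ (x == ord0) else 0.
    rewrite [RHS]big_mkcond big_edge; apply: eq_bigr => y _ /=.
    by do 4 case: ifP => _; rewrite ?mulr0n ?mulr1n ?addr0.
  rewrite natr_sum -big_split; apply: eq_bigr => -[b [x y]] eM /=.
  have -> : \sum_(i < r.+1 | odd i && (((b, (x, y)) \in (M : {set edge r})) &&
        incident (b, (x, y)) (ord_max, i))) 1 =
      \sum_(i < r.+1 | odd i && incident (b, (x, y)) (ord_max, i)) 1 :> int.
    by apply: eq_bigl => i; rewrite eM.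
  case: b eM => eM.
    (* A rung at height y contributes 1 for odd y and 0 for even y: at x = 0 as sign plus degree, at
       x = 1 by its degree alone. *)
    rewrite (eq_bigl (fun i => odd y && (i == y))); last first.
      by move=> i; rewrite incident_horizontal /=; case: eqP => [->|]; rewrite ?andbF.
    have -> : \sum_(i < r.+1 | odd y && (i == y)) 1 = (odd y)%:R :> int.
      by case: (odd y); [exact: big_pred1_eq | exact: big_pred0_eq].
    rewrite /orient /black /=.
    by case: x eM => [[|[|//]]] ? _ /=; case: (odd y).
  have yr : (y < r)%N.
    by case/andP: (valP M) => /subsetP/(_ _ eM); rewrite inE.
  (* Exactly one of the heights y, y + 1 is odd, so a vertical edge counts once if x = 1 and not at
     all if x = 0. *)
  rewrite (eq_bigl (fun i : 'I_r.+1 => (x == ord_max) &&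
      (i == if odd y then y else ordS y))); last first.
    move=> i; rewrite incident_vertical //= eq_sym andbCA; congr andb.
    rewrite -val_eqE; case: ifP => oy /=; rewrite ?modn_small //.
      by case: eqP => [->|]; rewrite ?oy //; case: eqP => [->|]; rewrite /= ?oy ?andbF.
    case: (_ == _.+1 :> nat) / eqP => [->|]; first by rewrite /= oy orbT.
    by case: eqP => [->|]; rewrite ?oy ?andbF.
  by case: x eM => [[|[|//]]] ? _ /=; rewrite ?big_pred1_eq ?big_pred0_eq ?add0r.
apply: eq_bigr => y _; case/andP: (valP M) => _ /forallP/(_ (ord_max, y))/eqP.
rewrite (eq_bigl (mem [set e in matching_val M | incident e (ord_max, y)])).
  by rewrite sumr_const => ->.
by move=> e; rewrite !inE.
Qed.

End Degree.

(** * The generating polynomial of matchings by degree *)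

Section GeneratingPolynomial.
Set Implicit Arguments.
Unset Strict Implicit.
Variables (r : nat) (F : fieldType).

Definition edge_weight (A : nat -> F) (e : edge r) : F :=
  (face_weight A (face_label (left_square e)) *
   face_weight A (face_label (right_square e)))^-1.

Definition gen_poly (A : nat -> F) : {poly F} :=
  \sum_(M : matching r) (weight A M / weight A (M0 r))%:P * 'X^(degree M).

Lemma degree_bound (M : {set edge r}) :
  (degree M < (\sum_(e : edge r) edge_degree e).+1)%N.
Proof.
rewrite ltnS /degree [leqRHS](bigID (mem M)) /=.
exact: leq_addr.
Qed.

Lemma homology_class_degree (M M' : matching r) :
  degree M = degree M' -> homology_class M = homology_class M'.
Proof.
move=> dM; apply: homology_class_flux.
by apply: (addIr (degree M)%:R); rewrite {2}dM !flux_degree.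
Qed.

(** As the degree determines the class, the matchings of degree n lie all in h or all outside it,
    whatever the weights. So the degree n part of the Hamiltonian is the coefficient of X^n or 0. *)
Lemma hamiltonian_gen_poly (A B : nat -> F) (h : H1 r) :
  gen_poly A = gen_poly B -> hamiltonian h A = hamiltonian h B.
Proof.
move=> AB; rewrite /hamiltonian.
pose N := (\sum_(e : edge r) edge_degree e)%N.
rewrite !(partition_big (fun M : matching r => inord (degree M) : 'I_N.+1) predT) //=.
apply: eq_bigr => n _.
have degE (M : matching r) : (inord (degree M) == n) = (degree M == n :> nat).
  by rewrite -val_eqE /= inordK // degree_bound.
have coefE C : (gen_poly C)`_n = \sum_(M : matching r | degree M == n :> nat)
    weight C M / weight C (M0 r).
  rewrite coef_sum [RHS]big_mkcond; apply: eq_bigr => M _.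
  by rewrite coefCM coefXn eq_sym; case: eqP; rewrite ?mulr1 ?mulr0.
pose P (M : matching r) := (homology_class M == h) && (inord (degree M) == n).
case: (pickP P) => [M /andP[/eqP Mh Mn]|none].
  have hE (C : nat -> F) :
      \sum_(M | P M) weight C M / weight C (M0 r) = (gen_poly C)`_n.
    rewrite coefE; apply: eq_bigl => M'; rewrite /P degE andb_idl // => /eqP M'n.
    rewrite -Mh; apply/eqP/homology_class_degree; rewrite M'n.
    by apply/esym/eqP; rewrite -degE.
  by rewrite [LHS]hE [RHS]hE AB.
by rewrite !big_pred0.
Qed.

(** * Edge weights on a slice and the continuant formula *)

Section Slice.
Variables (A u v : nat -> F).
Hypothesis Au : forall i, (0 < i <= r)%N -> A i = u i.
Hypothesis Av : forall i, (0 < i <= r)%N -> A (r + i)%N = v i.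
Hypotheses (u0 : u 0%N = 1) (v0 : v 0%N = 1) (u_top : u r.+1 = 1) (v_top : v r.+1 = 1).

(** The annulus, y = r, obeys the same formula because u and v are 1 at r + 1, the weight of face
    0. *)
Lemma face_weight_square (x : 'I_2) (y : 'I_r.+1) :
  face_weight A (face_label (x, y)) = if odd (x + y) then v y.+1 else u y.+1.
Proof.
rewrite /face_label /=; case: eqP => [->|/eqP yr].
  by rewrite /face_weight eqxx u_top v_top if_same.
have yr1 : (0 < y.+1 <= r)%N by have := ltn_ord y; lia.
have -> : ((x == 0 :> nat) == ~~ odd y) = ~~ odd (x + y).
  by case: x => [[|[|//]]] ? /=; case: (odd y).
case: odd => /=; rewrite /face_weight /=; last by rewrite Au.
by rewrite addnS /= -addnS Av.
Qed.

Lemma face_weight_below (x : 'I_2) (y : 'I_r.+1) :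
  face_weight A (face_label (x, ord_pred y)) = if odd (x + y) then u y else v y.
Proof.
rewrite face_weight_square /=; case: y => -[|n] ny /=.
  by rewrite modn_small // u0 v0 u_top v_top !if_same.
by rewrite modnDr modn_small 1?ltnW // addnS /=; case: odd.
Qed.

Lemma edge_weight_horizontal (x : 'I_2) (y : 'I_r.+1) :
  edge_weight A (true, (x, y)) =
  if odd (x + y) then (v y.+1 * u y)^-1 else (u y.+1 * v y)^-1.
Proof.
rewrite /edge_weight /left_square /right_square /=.
by rewrite face_weight_square face_weight_below; case: odd.
Qed.

Lemma edge_weight_vertical (x : 'I_2) (y : 'I_r.+1) :
  edge_weight A (false, (x, y)) = (u y.+1 * v y.+1)^-1.
Proof.
rewrite /edge_weight /left_square /right_square /= !face_weight_square.
by case: x => [[|[|//]]] ? /=; case: (odd y); rewrite /= // mulrC.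
Qed.

Lemma weight_M0 : weight A (M0 r) = \prod_(y < r.+1) (v y.+1 * u y)^-1.
Proof.
rewrite /weight -/(edge_weight A) big_mkcond big_edge; apply: eq_bigr => y _ /=.
rewrite !inE /black /= mulr1.
rewrite -!/(edge_weight A _) !edge_weight_horizontal /=.
by case: (odd y); rewrite ?mul1r ?mulr1.
Qed.

(* Weights of the rung outside M0 in row i, resp. of the vertical pair between
   rows i and i + 1, relative to the edges of M0 in the same rows. *)
Definition rung_ratio i : F := v i.+1 * u i / (u i.+1 * v i).
Definition vertical_ratio i : F := u i * v i.+2 / (u i.+1 * v i.+1).

Hypothesis u_neq0 : forall i, (i <= r.+1)%N -> u i != 0.
Hypothesis v_neq0 : forall i, (i <= r.+1)%N -> v i != 0.

Let w (e : edge r) : {poly F} := (edge_weight A e)%:P * 'X^(edge_degree e).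

Lemma gen_poly_matching_sum :
  gen_poly A = (weight A (M0 r))^-1%:P * matching_sum w (rows r r.+1).
Proof.
have rowsT : rows r r.+1 = setT by apply/setP => v'; rewrite !inE ltn_ord.
have matchesT M : matches (rows r r.+1) M = perfect M.
  rewrite rowsT /matches /perfect; congr andb; apply: eq_forallb => v'.
  by rewrite inE.
rewrite /matching_sum (eq_bigl _ _ matchesT).
rewrite (reindex_omap (val : matching r -> _) insub) /=; last first.
  by move=> M pM; rewrite insubT.
rewrite big_distrr /=; apply: eq_big => [M|M _]; first by rewrite (valP M) valK eqxx.
rewrite big_split /= prodrXr -rmorph_prod mulrA -rmorphM /=.
by rewrite [X in _ = X%:P * _]mulrC.
Qed.

(** The row recursion is that of a continuant; the weight [c i] of the [M0] rung in row i is then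
    pulled out of each row by [continuant_scale]. *)
Lemma gen_poly_continuant : gen_poly A =
  continuant (fun i => 1 + (rung_ratio i)%:P * 'X)
             (fun i => (vertical_ratio i)%:P * 'X) r.+1.
Proof.
rewrite gen_poly_matching_sum weight_M0.
pose c i : F := (v i.+1 * u i)^-1.
have c_neq0 i : (i <= r)%N -> c i != 0.
  by move=> ir; rewrite invr_eq0 mulf_neq0 ?u_neq0 ?v_neq0 // ltnW.
suff sumE m : (m <= r.+1)%N -> matching_sum w (rows r m) = continuant
    (fun i => (c i)%:P * (1 + (rung_ratio i)%:P * 'X))
    (fun i => (c i)%:P * (c i.+1)%:P * ((vertical_ratio i)%:P * 'X)) m.
  rewrite sumE // (continuant_scale (fun i => (c i)%:P)) -rmorph_prod mulrA -rmorphM /=.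
  rewrite mulVf ?mul1r //; apply/prodf_neq0 => i _.
  by apply: c_neq0; rewrite -ltnS.
elim/ltn_ind: m => -[|m] IH mr.
  by rewrite (_ : rows r 0 = set0) ?matching_sum0 //; apply/setP => v'; rewrite !inE.
have rowiE p : (p <= m)%N -> rowi r p = p :> nat.
  by move=> pm; rewrite inordK // (leq_ltn_trans pm).
have un i : (i <= m.+1)%N -> u i != 0 by move=> im; rewrite u_neq0 // (leq_trans im).
have vn i : (i <= m.+1)%N -> v i != 0 by move=> im; rewrite v_neq0 // (leq_trans im).
rewrite matching_sum_rows //= -IH //; last exact: ltnW.
congr (_ * _ + _).
  rewrite /w !edge_weight_horizontal /= !rowiE //.
  have cR : c m * rung_ratio m = (u m.+1 * v m)^-1.
    by rewrite /c /rung_ratio; field; rewrite !un ?vn.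
  (* The parity of m decides which of the two rungs belongs to [M0]; the other one carries the
     factor X. *)
  rewrite mulrDr mulr1 mulrA -polyCM cR /=.
  by case: (odd m); rewrite !(expr0, expr1, mulr1) // addrC.
case: m IH mr rowiE un vn => // p IH mr rowiE un vn.
rewrite -IH ?(leq_trans _ mr) //; last by rewrite ltnW // ltnW.
congr (_ * _).
rewrite /w !edge_weight_vertical /= !rowiE //.
(* Both edges of a vertical pair separate the same two faces, hence the square. *)
have cD : c p * c p.+1 * vertical_ratio p = (u p.+1 * v p.+1)^-1 * (u p.+1 * v p.+1)^-1.
  by rewrite /c /vertical_ratio; field; rewrite !un ?vn //; lia.
by rewrite expr0 expr1 mulr1 !mulrA -!polyCM cD.
Qed.

End Slice.

End GeneratingPolynomial.

(** * Invariance under one time step *)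

Lemma gen_poly_shift (r : nat) (F : fieldType) (A B u v w : nat -> F) :
    (forall i, (0 < i <= r)%N -> A i = u i) ->
    (forall i, (0 < i <= r)%N -> A (r + i)%N = v i) ->
    (forall i, (0 < i <= r)%N -> B i = v i) ->
    (forall i, (0 < i <= r)%N -> B (r + i)%N = w i) ->
    u 0%N = 1 -> v 0%N = 1 -> w 0%N = 1 ->
    u r.+1 = 1 -> v r.+1 = 1 -> w r.+1 = 1 ->
    (forall i, (i <= r.+1)%N -> u i != 0) ->
    (forall i, (i <= r.+1)%N -> v i != 0) ->
    (forall i, (i <= r.+1)%N -> w i != 0) ->
    (forall i, (i < r)%N -> w i.+1 * u i.+1 = v i.+1 ^+ 2 + v i.+2 * v i) ->
  gen_poly r A = gen_poly r B.
Proof.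
move=> Au Av Bv Bw u0 v0 w0 ut vt wt un vn wn Qsys.
rewrite (gen_poly_continuant Au Av) // (gen_poly_continuant Bv Bw) //.
(* Truncating v above r + 1 makes the last vertical ratio vanish. *)
pose v' i := if (i <= r.+1)%N then v i else 0.
have v'E i : (i <= r.+1)%N -> v' i = v i by rewrite /v' => ->.
have v'_out : v' r.+2 = 0 by rewrite /v' ltnn.
(* The Q-system solved for the new slice; in row r + 1 it reads 1 = 1 + 0 thanks to the
   truncation. *)
have wE i : (i <= r)%N -> w i.+1 = (v' i.+1 ^+ 2 + v' i.+2 * v' i) / u i.+1.
  rewrite leq_eqVlt => /orP[/eqP->|ir].
    by rewrite v'_out v'E // vt wt ut mul0r addr0 expr1n divr1.
  have [-> -> ->] : [/\ v' i = v i, v' i.+1 = v i.+1 & v' i.+2 = v i.+2].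
    by split; apply: v'E; lia.
  by rewrite -Qsys // mulfK // un //; lia.
have -> : continuant (fun i => 1 + (rung_ratio u v i)%:P * 'X)
    (fun i => (vertical_ratio u v i)%:P * 'X) r.+1 =
  continuant (fun i => 1 + (rung_ratio u v' i)%:P * 'X)
    (fun i => (vertical_ratio u v' i)%:P * 'X) r.+1.
  apply: eq_continuant => i ir; rewrite /rung_ratio /vertical_ratio !v'E //; lia.
have v'n i : (i <= r.+1)%N -> v' i != 0 by move=> ir; rewrite v'E ?vn.
rewrite (@eq_continuant _ (fun i => 1 + (rung_ratio v w i)%:P * 'X)
  (fun i => (vertical_ratio v w i)%:P * 'X) (fun i => 1 + (rung_ratio v' w i)%:P * 'X)
  (fun i => (vertical_ratio v' w i)%:P * 'X)); first last.
- by move=> i ir; rewrite /vertical_ratio !v'E //; lia.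
- by move=> i ir; rewrite /rung_ratio !v'E //; lia.
rewrite [RHS](@continuant_shift _ (fun i => 1 + (rung_ratio u v' i)%:P * 'X)
    (fun i => (vertical_ratio u v' i)%:P * 'X)).
- by rewrite /vertical_ratio v'_out mulr0 mul0r polyC0 mul0r mul0r addr0.
- rewrite -addrA -mulrDl -polyCD; congr (1 + _%:P * _).
  rewrite /rung_ratio /vertical_ratio (wE 0%N) // w0 u0 (v'E 0%N) // v0.
  by field; rewrite un ?v'n.
- move=> m mr; rewrite -!addrA -!mulrDl -!polyCD; congr (1 + _%:P * _).
  rewrite /rung_ratio /vertical_ratio.
  (* Over a common denominator R' + D' exhibits the right side of the Q-system in row m + 1;
     replacing it cancels [w m.+1], and row m + 2 then yields R + D. *)
  transitivity (w m.+2 * (v' m.+1 ^+ 2 + v' m.+2 * v' m) /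
      (v' m.+1 * v' m.+2 * w m.+1)).
    by field; rewrite ?wn ?v'n //; lia.
  have -> : v' m.+1 ^+ 2 + v' m.+2 * v' m = w m.+1 * u m.+1.
    by rewrite wE 1?ltnW // mulfVK // un //; lia.
  rewrite (wE m.+1) //.
  by field; rewrite ?wn ?v'n ?un //; lia.
(* Both products reduce to u_m w_(m+2) / (u_(m+1) w_(m+1)) by cancellation alone. *)
- move=> m mr; rewrite ![1 + _]addrC !addrK mulrACA [RHS]mulrACA -!polyCM.
  congr (_%:P * _).
  rewrite /rung_ratio /vertical_ratio.
  by field; rewrite ?wn ?v'n ?un //; lia.
Qed.

Local Open Scope complex_scope.

Theorem theorem5p1 (R : realType) (r : nat) (hr : (1 <= r)%N)
    (Q : nat -> int -> R[i])
    (Q_neq0 : forall (a : nat) (k : int), (1 <= a <= r)%N -> Q a k != 0)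
    (Q_system : forall (a : nat) (k : int), (1 <= a <= r)%N ->
       Q a (k + 1) * Q a (k - 1) = Q a k ^+ 2 + Q a.+1 k * Q a.-1 k)
    (Q_bot : forall k : int, Q 0%N k = 1)
    (Q_top : forall k : int, Q r.+1 k = 1)
    (h : H1 r) (k : int) :
  hamiltonian h (Q_slice r Q k) = hamiltonian h (Q_slice r Q (k + 1)).
Proof.
apply: hamiltonian_gen_poly.
have low j i : (0 < i <= r)%N -> Q_slice r Q j i = Q i j.
  by move=> /andP[_ ir]; rewrite /Q_slice ir.
have high j i : (0 < i <= r)%N -> Q_slice r Q j (r + i)%N = Q i (j + 1).
  by move=> /andP[i0 _]; rewrite /Q_slice leqNgt -addn1 leq_add2l i0 addKn.
have Qn j i : (i <= r.+1)%N -> Q i j != 0.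
  rewrite leq_eqVlt => /orP[/eqP->|]; first by rewrite Q_top oner_neq0.
  by case: i => [|i] ir; [rewrite Q_bot oner_neq0 | apply: Q_neq0].
(* Consecutive slices share the middle time k + 1, at which the Q-system is applied. *)
apply: (@gen_poly_shift r _ _ _ (Q^~ k) (Q^~ (k + 1)) (Q^~ (k + 1 + 1)) (low k) (high k)
  (low (k + 1)) (high (k + 1))) => //; try exact: Qn.
by move=> i ir; have := Q_system i.+1 (k + 1) ir; rewrite addrK.
Qed.
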